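(* Let $\alpha\in\mathbb{R}$ be irrational of finite type $\eta$, and let $\epsilon=R^{-\lambda}$ for a fixed real $\lambda$. Then, in the limit as $R\to\infty$, $$S_\alpha(\epsilon,R)=\begin{cases}\mathrm{Area}(\mathrm{Sect}_{\alpha,\epsilon}(R))+O(R), & 0\le\lambda<\frac12,\\[2pt] \mathrm{Area}(\mathrm{Sect}_{\alpha,\epsilon}(R))+O\left(R^{2-2\lambda}\right), & \frac12\le\lambda<\frac{1+\eta}{1+2\eta},\\[2pt] \mathrm{Area}(\mathrm{Sect}_{\alpha,\epsilon}(R))+O\left(R^{1-\frac{\lambda}{1+\eta}}\right), & \frac{1+\eta}{1+2\eta}\le\lambda<1+\frac1\eta.\end{cases}$$
   Context: An irrational $\alpha\in\mathbb{R}$ is said to be of finite type $\eta$ (a real number) if there exists a constant $c=c(\alpha)>0$ such that $\left|\alpha-\frac pq\right|>\frac{c}{q^{1+\eta}}$ for all pairs $(p,q)\in\mathbb{Z}\times\mathbb{Z}_{>0}$ (necessarily $\eta\ge1$ by Dirichlet's theorem). For $\alpha\in\mathbb{R}$, $\epsilon>0$, $R>0$ define the sector $$\mathrm{Sect}_{\alpha,\epsilon}(R):=\{(x,y)\in\mathbb{R}_{>0}\times\mathbb{R}:\ x^2+y^2\le R^2,\ \alpha-\epsilon<y/x<\alpha+\epsilon\},$$ whose area is $\mathrm{Area}(\mathrm{Sect}_{\alpha,\epsilon}(R))=\frac{R^2}{2}\left(\tan^{-1}(\alpha+\epsilon)-\tan^{-1}(\alpha-\epsilon)\right)$, and let $$S_\alpha(\epsilon,R):=\#\left(\mathbb{Z}^2\cap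 \mathrm{Sect}_{\alpha,\epsilon}(R)\right)=\#\{(m,n)\in\mathbb{Z}_{>0}\times\mathbb{Z}: m^2+n^2\le R^2,\ |n-\alpha m|<m\epsilon\}.$$ The $O$-notation refers to the limit $R\to\infty$ with $\alpha$, $\eta$ and $\lambda$ fixed: the bounds hold for all sufficiently large $R$ with implied constants not depending on $R$. *)

(* Defs.v *)
From HB Require Import structures.
From mathcomp Require Import all_boot all_order all_algebra.
From mathcomp Require Import finmap.
From mathcomp Require Import all_classical all_reals all_analysis.

Set Implicit Arguments.
Unset Strict Implicit.
Unset Printing Implicit Defensive.

Import Order.TTheory GRing.Theory Num.Theory.
Import numFieldNormedType.Exports.

Local Open Scope classical_set_scope.
Local Open Scope ring_scope.

Definition finite_type {R : realType} (alpha eta : R) : Prop :=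
  exists2 c : R, 0 < c &
    forall p q : int, 0 < q ->
      c / q%:~R `^ (1 + eta) < `|alpha - p%:~R / q%:~R|.

Definition Sect {R : realType} (alpha eps r : R) : set (R * R) :=
  [set z | [/\ 0 < z.1, z.1 ^+ 2 + z.2 ^+ 2 <= r ^+ 2 &
               alpha - eps < z.2 / z.1 < alpha + eps]].

(* [fine] is harmless here: sectors are bounded, hence of finite area. *)
Definition Area {R : realType} (D : set (R * R)) : R :=
  fine ((lebesgue_measure \x lebesgue_measure)%E D).

(* Sectors are bounded, so the set below is finite; [fset_set] would send an
   infinite set to the empty one. *)
Definition lattice_count {R : realType} (alpha eps r : R) : nat :=
  #|` fset_set [set mn : int * int |
                 Sect alpha eps r (mn.1%:~R, mn.2%:~R)]|%fset.

(* Registered so that the notation [+O_ +oo] finds the filter structure. *)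
Canonical pinfty_filter_on (R : realType) : filter_on R :=
  FilterType (pinfty_nbhs R) _.

(* Main.v *)
Require Import Defs.
From mathcomp Require Import all_boot all_order all_algebra.
From mathcomp Require Import finmap.
From mathcomp Require Import all_classical all_reals all_analysis.
From mathcomp Require Import measurable_realfun zify ring lra.
Import Order.TTheory GRing.Theory Num.Theory.
Import numFieldNormedType.Exports.
Local Open Scope classical_set_scope.
Local Open Scope ring_scope.

(** Let [eps = r ^ (- lambda)] and let [s(x) = sqrt(r^2 - x^2)] be the height of
    the half disc above [x].  The vertical section of the sector at abscissa [x]
    is an interval whose length [l(x)] is the positive part of
    [min((alpha + eps) x, s(x)) - max((alpha - eps) x, - s(x))].  By Fubini the
    area is the integral of [l], while the lattice count is a sum over the
    columns [m = 1, 2, ...] of a number of integers that differs from [l(m)] by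
    at most 1.  So the error splits into a Riemann sum error and a rounding
    error.

    For [lambda < 1/2] both are trivially [O(r)]: there are at most [r] columns,
    and [l] has total variation [O(r)] ([lattice_count_convex]).

    For larger [lambda] the columns fall into three groups.  Up to some
    [M <= r] the arc is not reached and the section is the full interval
    [|y - alpha x| < eps x]; after a transition range of [O(1 + eps r)] columns
    the sections are empty.  Sections have length [O(eps r)], so the transition
    range contributes [O((1 + eps r)^2)], as does the Riemann sum error
    ([lattice_count_wedge]).  There remains the rounding error of the full
    columns.  It is a sum of values of the sawtooth function at
    [(alpha - eps) m] and [- (alpha + eps) m], which is where the Diophantine
    type enters.

    Cut the columns into blocks of [q] consecutive ones, where [p / q] is an
    irreducible fraction close to [alpha].  Along a block [alpha m] runs, up to
    a small error, through all the residues mod 1 of step [1 / q] exactly once,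
    so the sawtooth values cancel down to [O(1 + q^2 eps)]
    ([norm_sum_sawtooth]).  An incomplete last block is handled by positivity:
    column counts are nonnegative, so their partial sums lie between those over
    complete blocks ([sum_wedge_count]).  The total is [O(r / q + r q eps)].
    Dirichlet's theorem with a bound [X] on the denominator gives [q <= X] and
    [|alpha - p / q| <= 1 / (q X)], up to the rounding of [X]; the finite type
    of [alpha] then forces [q] to be at least a constant times [X^(1/eta)].
    The choice [X = eps^(- eta / (1 + eta))] balances both terms and yields
    [O(r eps^(1 / (1 + eta))) = O(r^(1 - lambda / (1 + eta)))].  It requires
    [X <= r], that is [lambda <= 1 + 1 / eta]
    ([sum_wedge_count_finite_type]).

    So the error is [O(r^(1 - lambda / (1 + eta)) + (1 + r^(1 - lambda))^2)],
    and [lambda = (1 + eta) / (1 + 2 eta)] is the point where the two terms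
    balance. *)

(** * Cancellation in sawtooth sums *)

(** The shift by one half gives it mean zero over a period. *)
Definition sawtooth {R : realType} (x : R) : R := x - (Num.floor x)%:~R - 2^-1.

(** Only the integer part [z] of [q y] matters for the position of
    [y + a / q] in the grid of step [1 / q]: the fractional part of [y + a / q] is
    the residue of [z + a] mod [q], divided by [q], plus what [q y] exceeds [z]
    by, divided by [q]. *)
Lemma sawtooth_quo {R : realType} (q : nat) (y : R) (a : int) : (0 < q)%N ->
  let z := Num.floor (q%:R * y) in
  sawtooth (y + a%:~R / q%:R) =
    (q%:R * y - z%:~R) / q%:R + ((z + a) %% q%:Z)%Z%:~R / q%:R - 2^-1.
Proof.
move=> q0 z; have q0R : 0 < q%:R :> R by rewrite ltr0n.
have qn0 : q%:R != 0 :> R by rewrite gt_eqF.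
have zE := divz_eq (z + a) q%:Z.
have /andP[z1 z2] := floor_itv (q%:R * y); rewrite -/z intrD in z1 z2.
have zER : z%:~R + a%:~R =
    ((z + a) %/ q%:Z)%Z%:~R * q%:R + ((z + a) %% q%:Z)%Z%:~R :> R.
  by rewrite -intrD {1}zE intrD intrM.
have r0 : 0 <= ((z + a) %% q%:Z)%Z%:~R :> R.
  by rewrite ler0z modz_ge0 ?eqz_nat -?lt0n.
have r1 : ((z + a) %% q%:Z)%Z%:~R + 1 <= q%:R :> R.
  by rewrite -[1]/(1%:~R) -intrD -[q%:R]/(q%:Z%:~R) ler_int lezD1 ltz_pmod.
have yE : y + a%:~R / q%:R =
    ((z + a) %/ q%:Z)%Z%:~R + (q%:R * y - z%:~R) / q%:R
      + ((z + a) %% q%:Z)%Z%:~R / q%:R.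
  have -> : a%:~R = ((z + a) %/ q%:Z)%Z%:~R * q%:R
    + ((z + a) %% q%:Z)%Z%:~R - z%:~R :> R by lra.
  by field.
rewrite /sawtooth yE.
have -> : Num.floor (((z + a) %/ q%:Z)%Z%:~R + (q%:R * y - z%:~R) / q%:R
    + ((z + a) %% q%:Z)%Z%:~R / q%:R) = ((z + a) %/ q%:Z)%Z.
  apply: floor_def; rewrite intrD -addrA -mulrDl lerDl ltrD2l.
  rewrite ltr_pdivrMr// mul1r divr_ge0 ?(ltW q0R)//=; last by lra.
  by lra.
by ring.
Qed.

(** [i |-> z + p i] permutes the residue classes, since [p] is invertible
    mod [q]. *)
Lemma sum_residues (q : nat) (p z : int) : (0 < q)%N -> coprimez p q%:Z ->
  \sum_(i < q) ((z + p * i%:Z) %% q%:Z)%Z = \sum_(i < q) i%:Z.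
Proof.
case: q => // q _ cpq.
have q0 : q.+1%:Z != 0 by [].
pose f (i : 'I_q.+1) : 'I_q.+1 := inord `|((z + p * i%:Z) %% q.+1%:Z)%Z|.
have fE i : (f i)%:Z = ((z + p * i%:Z) %% q.+1%:Z)%Z.
  have := modz_ge0 (z + p * i%:Z) q0; have := ltz_pmod (z + p * i%:Z) (isT : 0 < q.+1%:Z).
  by move=> h1 h2; rewrite inordK; lia.
rewrite [RHS](reindex_inj (h := f)); last first.
  move=> i j fij; apply/val_inj => /=.
  have /eqP : ((z + p * i%:Z) = (z + p * j%:Z) %[mod q.+1%:Z])%Z by rewrite -!fE fij.
  rewrite eqz_modDl eqz_mod_dvd -mulrBr Gauss_dvdzr 1?coprimez_sym//.
  have := ltn_ord i; have := ltn_ord j; move: (val i) (val j) => {fij} {}i {}j.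
  move=> jq iq.
  rewrite -eqz_mod_dvd => /eqP; rewrite !modz_small; lia.
by apply: eq_bigr => i _; rewrite fE.
Qed.

(** By [sawtooth_quo] the sum is the fractional part of [q y], plus the sum of
    the residues divided by [q], minus [q / 2]; the last two add up to [- 1/2]. *)
Lemma norm_sum_sawtooth_quo {R : realType} (q : nat) (p : int) (y : R) :
  (0 < q)%N -> coprimez p q%:Z ->
  `|\sum_(i < q) sawtooth (y + (p * i%:Z)%:~R / q%:R)| <= 2^-1.
Proof.
move=> q0 cpq; have q0R : 0 < q%:R :> R by rewrite ltr0n.
have qn0 : q%:R != 0 :> R by rewrite gt_eqF.
under eq_bigr => i _ do rewrite sawtooth_quo//.
rewrite !big_split/= !sumr_const !card_ord -mulr_suml -rmorph_sum/= sum_residues//.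
have -> : (\sum_(i < q) i%:Z)%:~R = q%:R * (q%:R - 1) / 2 :> R.
  rewrite rmorph_sum/= {q0 q0R qn0 cpq}; elim: q => [|q ih].
    by rewrite big_ord0 mul0r mul0r.
  by rewrite big_ord_recr/= ih -[q.+1]addn1 natrD; field.
have /andP[z1 z2] := floor_itv (q%:R * y); rewrite intrD in z1 z2.
set z := (Num.floor _)%:~R in z1 z2 *.
rewrite -(mulr_natl (_ / _)) -(mulr_natl (- _)).
have -> : q%:R * ((q%:R * y - z) / q%:R) + q%:R * (q%:R - 1) / 2 / q%:R
  + q%:R * - 2^-1 = q%:R * y - z - 2^-1 by field.
by rewrite ler_norml; lra.
Qed.

(** Replacing [beta] by [p / q] moves each argument by at most [d = q tau].
    The integer part is monotone, so up to [2 d] the values lie between those at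
    [p / q] shifted by [- d] and by [d], to which [norm_sum_sawtooth_quo]
    applies. *)
Lemma norm_sum_sawtooth {R : realType} (q : nat) (p : int) (beta tau y : R) :
  (0 < q)%N -> coprimez p q%:Z -> `|beta - p%:~R / q%:R| <= tau ->
  `|\sum_(i < q) sawtooth (y + beta * i%:R)| <= 2^-1 + 2 * q%:R ^+ 2 * tau.
Proof.
move=> q0 cpq btau; have q0R : 0 < q%:R :> R by rewrite ltr0n.
have qn0 : q%:R != 0 :> R by rewrite gt_eqF.
pose u (i : 'I_q) : R := (p * i%:Z)%:~R / q%:R.
pose d := q%:R * tau.
have uv (i : 'I_q) : `|beta * i%:R - u i| <= d.
  have -> : beta * i%:R - u i = i%:R * (beta - p%:~R / q%:R) :> R.
    by rewrite /u intrM; field.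
  rewrite normrM normr_nat /d ler_pM// ler_nat; exact: ltnW.
have sawtooth_lower (a b : R) : a <= b -> sawtooth b - (b - a) <= sawtooth a.
  move=> ab; rewrite /sawtooth.
  have : (Num.floor a)%:~R <= (Num.floor b)%:~R :> R by rewrite ler_int le_floor.
  by lra.
have sumc c : \sum_(i < q) (c : R) = q%:R * c.
  by rewrite sumr_const card_ord mulr_natl.
have lo := norm_sum_sawtooth_quo q p (y + d) q0 cpq.
have hi := norm_sum_sawtooth_quo q p (y - d) q0 cpq.
have lo' : \sum_(i < q) sawtooth (y + d + u i) - q%:R * (2 * d)
           <= \sum_(i < q) sawtooth (y + beta * i%:R).
  rewrite -sumc -sumrB; apply: ler_sum => i _.
  have := uv i; rewrite ler_norml => /andP[h1 h2].
  have := sawtooth_lower (y + beta * i%:R) (y + d + u i); lra.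
have hi' : \sum_(i < q) sawtooth (y + beta * i%:R) <=
    \sum_(i < q) sawtooth (y - d + u i) + q%:R * (2 * d).
  rewrite -sumc -big_split; apply: ler_sum => i _ /=.
  have := uv i; rewrite ler_norml => /andP[h1 h2].
  have := sawtooth_lower (y - d + u i) (y + beta * i%:R); lra.
have -> : 2 * q%:R ^+ 2 * tau = q%:R * (2 * d) by rewrite /d; ring.
by move: lo hi; rewrite !ler_norml -/u; lra.
Qed.

(** * Rational approximation *)

(** Pigeonhole on the fractional parts of [i alpha] for [0 <= i <= N], sorted
    into [N] bins of width [1 / N].  Dividing [p] and [q] by their gcd only
    decreases [q] and the distance of [q alpha] to [p]. *)
Lemma coprime_dirichlet_approx {R : realType} (alpha : R) (N : nat) : (0 < N)%N ->
  exists p : int, exists q : nat,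
    [/\ (0 < q <= N)%N, coprimez p q%:Z & `|alpha - p%:~R / q%:R| <= (q%:R * N%:R)^-1].
Proof.
case: N => // N _.
pose fr (i : nat) : R := i%:R * alpha - (Num.floor (i%:R * alpha))%:~R.
have frP i : 0 <= fr i < 1.
  have := floor_itv (i%:R * alpha); rewrite intrD /fr; lra.
pose bin (i : 'I_N.+2) : 'I_N.+1 := inord (Num.truncn (N.+1%:R * fr i)).
have binP (i : 'I_N.+2) : (bin i)%:R <= N.+1%:R * fr i < (bin i).+1%:R.
  have /andP[f0 f1] := frP i.
  have h0 : 0 <= N.+1%:R * fr i by rewrite mulr_ge0.
  rewrite inordK; first exact: truncn_itv.
  rewrite truncn_lt_nat// -[ltRHS]mulr1 ltr_pM2l//.
have /injectivePn[i [j ij bij]] : ~~ injectiveb bin.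
  apply/negP => /injectiveP /leq_card; rewrite !card_ord; lia.
wlog lij : i j ij bij / (i < j)%N => [hw|].
  have [|h|h] := ltngtP i j; first exact: hw.
    by apply: (hw j i) => //; rewrite eq_sym.
  by move: ij; rewrite (val_inj h) eqxx.
pose q := (j - i)%N; pose p := Num.floor (j%:R * alpha) - Num.floor (i%:R * alpha).
have q0 : (0 < q)%N by rewrite subn_gt0.
have qN : (q <= N.+1)%N by have := ltn_ord j; rewrite /q; lia.
have hq : N.+1%:R * `|q%:R * alpha - p%:~R| <= 1.
  rewrite -[N.+1%:R]normr_nat -normrM.
  have -> : N.+1%:R * (q%:R * alpha - p%:~R) = N.+1%:R * fr j - N.+1%:R * fr i.
    have -> : q%:R = j%:R - i%:R :> R by rewrite natrB// ltnW.
    by rewrite /p /fr intrB; move: (N.+1%:R : R) => n; ring.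
  have := binP i; have := binP j; rewrite bij -[(bin j).+1%:R]natr1.
  move: (_ * fr j) (_ * fr i) ((bin j)%:R : R) => a b c hj hi.
  by rewrite ler_norml; lra.
pose g := gcdz p q%:Z.
have g0 : 0 < g by rewrite ltz_nat gcdn_gt0 absz_nat q0 orbT.
have [p' pE] := dvdzP (dvdz_gcdl p q%:Z).
have [q' qE] := dvdzP (dvdz_gcdr p q%:Z).
rewrite -/g in pE qE.
have q'0 : 0 < q' by rewrite -(pmulr_lgt0 _ g0) -qE; lia.
have q'q : q' <= q%:Z by rewrite qE; apply: ler_peMr (ltW q'0) _; rewrite -gtz0_ge1.
have cpq : coprimez p' q'.
  have := mulz_gcdl p' q' g; rewrite -pE -qE -/g gtz0_abs// => /eqP.
  rewrite -subr_eq0 -[X in _ - X]mul1r -mulrBl mulf_eq0 subr_eq0.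
  by rewrite (gt_eqF g0) orbF.
have q'E : `|q'|%N%:Z = q' by lia.
exists p', `|q'|%N; split; [lia|by rewrite q'E|].
have qR : q%:R = q'%:~R * g%:~R :> R by rewrite -intrM -qE.
have pR : p%:~R = p'%:~R * g%:~R :> R by rewrite -intrM -pE.
have q'R : `|q'|%N%:R = q'%:~R :> R by rewrite -{2}q'E.
have g1 : 1 <= g%:~R :> R by rewrite ler1z -gtz0_ge1.
have q0' : 0 < q'%:~R :> R by rewrite ltr0z.
rewrite q'R.
have -> : alpha - p'%:~R / q'%:~R = (q'%:~R * alpha - p'%:~R) / q'%:~R :> R.
  by field; rewrite gt_eqF.
rewrite normrM [X in _ * X]gtr0_norm ?invr_gt0// invfM mulrC ler_pM2l ?invr_gt0//.
rewrite -[leRHS]mul1r ler_pdivlMr//.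
move: hq; rewrite qR pR.
have -> : q'%:~R * g%:~R * alpha - p'%:~R * g%:~R
  = (q'%:~R * alpha - p'%:~R) * g%:~R :> R by ring.
have g0R : 0 < g%:~R :> R by lra.
rewrite normrM (gtr0_norm g0R) => h; apply: le_trans h; rewrite mulrC.
by rewrite ler_wpM2l ?ler_peMr.
Qed.

(** A good approximation of a number of finite type cannot have a small
    denominator. *)
Lemma finite_type_exponent {R : realType} (eta c delta : R) (q N : nat) :
  (0 < q)%N -> (0 < N)%N -> c / q%:R `^ (1 + eta) < delta ->
  delta <= (q%:R * N%:R)^-1 -> c * N%:R < q%:R `^ eta.
Proof.
move=> q0 N0 h1 h2; have := lt_le_trans h1 h2.
have q0R : 0 < q%:R :> R by rewrite ltr0n.
have N0R : 0 < N%:R :> R by rewrite ltr0n.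
rewrite powRD ?(gt_eqF q0R) ?implybT// powRr1 ?(ltW q0R)//.
rewrite ltr_pdivrMr ?mulr_gt0 ?powR_gt0// invfM mulrACA mulVf ?gt_eqF// mul1r.
by rewrite mulrC ltr_pdivlMr.
Qed.

(** Dirichlet's theorem provides denominators [q <= N] with
    [c N < q ^ eta <= N ^ eta]; for [eta < 1] this fails as [N] grows.
    The maximum with 0 keeps [t |-> t ^ e] nondecreasing when [eta] is
    negative. *)
Lemma finite_type_ge1 {R : realType} (alpha eta : R) :
  finite_type alpha eta -> 1 <= eta.
Proof.
case=> c c0 ac; rewrite leNgt; apply/negP => eta1.
pose e := Num.max eta 0.
have e1 : e < 1 by rewrite gt_max eta1 ltr01.
have e0 : 0 <= e by rewrite le_max lexx orbT.
have ee : eta <= e by rewrite le_max lexx.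
pose X := (c^-1 + 1) `^ ((1 - e)^-1).
have c1 : 1 <= c^-1 + 1 by rewrite lerDr invr_ge0 ltW.
have X0 : 0 <= X by exact: powR_ge0.
have [p [q [/andP[q0 qN] _ pq]]] :=
  @coprime_dirichlet_approx R alpha (Num.truncn X).+1 isT.
set N := (Num.truncn X).+1 in qN pq.
have XN : X < N%:R := truncnS_gt X.
have q1 : 1 <= q%:R :> R by rewrite ler1n.
have N0 : 0 < N%:R :> R by rewrite ltr0n.
have cN := finite_type_exponent eta c _ q N q0 isT (ac p q%:Z q0) pq.
have : c * N%:R < N%:R `^ e.
  apply: lt_le_trans cN _; apply: le_trans (ler_powR q1 ee) _.
  by rewrite ge0_ler_powR// ?nnegrE ?ler_nat// ltW.
apply/negP; rewrite -leNgt.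
have NE : N%:R = N%:R `^ e * N%:R `^ (1 - e) :> R.
  by rewrite -powRD ?(gt_eqF N0) ?implybT// addrC subrK powRr1// ltW.
rewrite [X in c * X]NE mulrCA -[leLHS]mulr1 ler_pM2l ?powR_gt0//.
rewrite mulrC -ler_pdivrMr// div1r.
have -> : c^-1 = X `^ (1 - e) - 1.
  by rewrite /X -powRrM mulVf ?powRr1 ?addrK//; lra.
apply: le_trans (_ : X `^ (1 - e) <= _); first by lra.
by rewrite ge0_ler_powR ?nnegrE; lra.
Qed.

(** * Lattice points in the wedge *)

(** For [m > 0] this is the number of integers [n] with [|n - alpha m| < eps m],
    when [eps > 0]; for [m = 0] the formula gives [-1]. *)
Definition wedge_count {R : realType} (alpha eps : R) (m : nat) : R :=
  (Num.ceil ((alpha + eps) * m%:R) - Num.floor ((alpha - eps) * m%:R) - 1)%:~R.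

Lemma wedge_count_sawtooth {R : realType} (alpha eps : R) (m : nat) :
  wedge_count alpha eps m - 2 * eps * m%:R =
  sawtooth (- (alpha + eps) * m%:R) + sawtooth ((alpha - eps) * m%:R).
Proof.
rewrite /wedge_count /sawtooth !intrB ceilNfloor mulNr intrN -[1%:~R]/(1 : R).
set u := (Num.floor _)%:~R; set v := (Num.floor _)%:~R; lra.
Qed.

Lemma wedge_count_ge0 {R : realType} (alpha eps : R) (m : nat) : 0 < eps ->
  0 <= wedge_count alpha eps m.+1.
Proof.
move=> e0; rewrite ler0z subr_ge0 -gtz0_ge1 subr_gt0 -(ltr_int R).
have m0 : 0 < m.+1%:R :> R by [].
apply: le_lt_trans (floor_le _) _; apply: lt_le_trans _ (ceil_ge _).
by rewrite ltr_pM2r//; lra.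
Qed.

(** The two sawtooth terms have slopes [- (alpha + eps)] and [alpha - eps], close
    to [- p / q] and [p / q]. *)
Lemma sum_wedge_count_block {R : realType} (alpha eps : R) (q : nat) (p : int)
    (m : nat) : (0 < q)%N -> coprimez p q%:Z -> 0 <= eps ->
  `|\sum_(i < q) (wedge_count alpha eps (m + i) - 2 * eps * (m + i)%:R)| <=
  1 + 4 * q%:R ^+ 2 * (`|alpha - p%:~R / q%:R| + eps).
Proof.
move=> q0 cpq e0; under eq_bigr => i _ do rewrite wedge_count_sawtooth natrD !mulrDr.
rewrite big_split/=; apply: le_trans (ler_normD _ _) _.
set tau := `|_| + eps.
have h1 : `|- (alpha + eps) - (- p)%:~R / q%:R| <= tau.
  have -> : - (alpha + eps) - (- p)%:~R / q%:R = - ((alpha - p%:~R / q%:R) + eps).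
    by rewrite intrN; ring.
  by rewrite normrN (le_trans (ler_normD _ _))// (ger0_norm e0).
have h2 : `|(alpha - eps) - p%:~R / q%:R| <= tau.
  have -> : alpha - eps - p%:~R / q%:R = (alpha - p%:~R / q%:R) - eps by ring.
  by rewrite (le_trans (ler_normB _ _))// (ger0_norm e0).
have cNpq : coprimez (- p) q%:Z by rewrite coprimeNz.
have := norm_sum_sawtooth q _ _ _ (- (alpha + eps) * m%:R) q0 cNpq h1.
have := norm_sum_sawtooth q _ _ _ ((alpha - eps) * m%:R) q0 cpq h2.
by move: `|_| `|_| => a b; lra.
Qed.

Lemma sum_wedge_count_blocks {R : realType} (alpha eps : R) (q : nat) (p : int)
    (K : nat) : (0 < q)%N -> coprimez p q%:Z -> 0 <= eps ->
  `|\sum_(i < K * q) (wedge_count alpha eps i.+1 - 2 * eps * i.+1%:R)| <=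
  K%:R * (1 + 4 * q%:R ^+ 2 * (`|alpha - p%:~R / q%:R| + eps)).
Proof.
move=> q0 cpq e0; elim: K => [|K ih]; first by rewrite big_ord0 normr0 mul0r.
rewrite mulSnr big_split_ord/= -[K.+1%:R]natr1 [leRHS]mulrDl [1 * _]mul1r.
apply: le_trans (ler_normD _ _) _; apply: lerD => //.
exact: (sum_wedge_count_block alpha eps q p (K * q).+1).
Qed.

(** The trivial bound [q / 2] on the sawtooth sum over an incomplete block would
    be too large when [eps r] is small, so the last block is treated through the
    nonnegativity of the counts; the price is the mass [2 eps m] summed over one
    block. *)
Lemma sum_wedge_count {R : realType} (alpha eps : R) (q : nat) (p : int) (M : nat) :
  (0 < q)%N -> coprimez p q%:Z -> 0 < eps ->
  `|\sum_(i < M) (wedge_count alpha eps i.+1 - 2 * eps * i.+1%:R)| <=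
  (M%:R / q%:R + 1) * (1 + 4 * q%:R ^+ 2 * (`|alpha - p%:~R / q%:R| + eps)) +
  2 * eps * q%:R * (M%:R + q%:R).
Proof.
move=> q0 cpq e0; have q0R : 0 < q%:R :> R by rewrite ltr0n.
set E := 1 + _.
have E0 : 0 <= E.
  by rewrite addr_ge0// mulr_ge0// ?(addr_ge0 _ (ltW e0))// mulr_ge0// sqr_ge0.
set K := (M %/ q)%N.
have KM : (K * q <= M)%N := leq_divM M q.
have MK : (M <= K.+1 * q)%N by rewrite ltnW// ltn_ceil.
have KMR : K%:R <= M%:R / q%:R :> R by rewrite ler_pdivlMr// -natrM ler_nat.
(* compares the sums up to [M] with those up to the multiples of [q] around it *)
have mono (f : nat -> R) a b : (forall i, 0 <= f i) -> (a <= b)%N ->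
    \sum_(i < a) f i <= \sum_(i < b) f i.
  move=> f0 ab; rewrite -(subnKC ab) big_split_ord/= lerDl.
  by apply: sumr_ge0 => i _.
pose f i := wedge_count alpha eps i.+1; pose g i : R := 2 * eps * i.+1%:R.
have f0 i : 0 <= f i by exact: wedge_count_ge0.
have g0 i : 0 <= g i by rewrite !mulr_ge0// ltW.
have gq : \sum_(i < K.+1 * q) g i - \sum_(i < K * q) g i <=
          2 * eps * q%:R * (M%:R + q%:R).
  rewrite mulSnr big_split_ord/= addrAC subrr add0r.
  have -> : 2 * eps * q%:R * (M%:R + q%:R) = \sum_(i < q) (2 * eps * (M%:R + q%:R)).
    by rewrite sumr_const card_ord -mulr_natl; ring.
  apply: ler_sum => i _; rewrite /g ler_pM2l ?mulr_gt0// -natrD ler_nat.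
  by have := ltn_ord i; lia.
have b1 := sum_wedge_count_blocks alpha eps q p K q0 cpq (ltW e0).
have b2 := sum_wedge_count_blocks alpha eps q p K.+1 q0 cpq (ltW e0).
rewrite !sumrB -/E in b1 b2 *.
have f1 := mono f _ _ f0 KM; have f2 := mono f _ _ f0 MK.
have g1 := mono g _ _ g0 KM; have g2 := mono g _ _ g0 MK.
have KE : K.+1%:R * E <= (M%:R / q%:R + 1) * E.
  by rewrite ler_wpM2r// -natr1 lerD2r.
have KE' : K%:R * E <= K.+1%:R * E by rewrite ler_wpM2r// ler_nat.
move: b1 b2 f1 f2 g1 g2 gq KE KE'.
rewrite /f /g !ler_norml.
set s0 := \sum_(i < K * q) wedge_count _ _ _; set s1 := \sum_(i < M) wedge_count _ _ _.
set s2 := \sum_(i < K.+1 * q) wedge_count _ _ _.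
set t0 := \sum_(i < K * q) _; set t1 := \sum_(i < M) _.
set t2 := \sum_(i < K.+1 * q) _.
move: (K%:R * E) (K.+1%:R * E) ((_ + 1) * E) (2 * eps * _ * _) => x y z w.
lra.
Qed.

(** The denominator bound [X = eps ^ (- eta / (1 + eta))] balances the two
    error terms [r / q] and [r q eps], and it is at most [r] because
    [lambda < 1 + 1 / eta]. *)
Lemma sum_wedge_count_finite_type {R : realType} (alpha eta lambda : R) :
  finite_type alpha eta -> 0 <= lambda < 1 + eta^-1 ->
  exists2 C : R, 0 <= C & forall (r : R) (M : nat), 1 <= r -> M%:R <= r ->
    `|\sum_(i < M) (wedge_count alpha (r `^ (- lambda)) i.+1
                     - 2 * r `^ (- lambda) * i.+1%:R)| <=
    C * r `^ (1 - lambda / (1 + eta)).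
Proof.
move=> ft /andP[l0 l1]; have eta1 := finite_type_ge1 _ _ ft.
have eta0 : 0 < eta by lra.
case: ft => c c0 ac.
have c20 : 0 < (c / 2) `^ eta^-1 by rewrite powR_gt0//; lra.
exists (10 / (c / 2) `^ eta^-1 + 12) => [|r M r1 Mr].
  by rewrite addr_ge0// divr_ge0// ltW.
have r0 : 0 < r by lra.
have rn0 : r != 0 by rewrite gt_eqF.
set eps := r `^ (- lambda); have eps0 : 0 < eps by rewrite powR_gt0.
pose X := r `^ (lambda * eta / (1 + eta)).
have X1 : 1 <= X.
  rewrite /X -{1}(powRr0 r) ler_powR// divr_ge0 ?mulr_ge0//; lra.
have Xr : X <= r.
  rewrite /X -{2}(powRr1 (ltW r0)) ler_powR// ler_pdivrMr; last by lra.
  have : lambda * eta < (1 + eta^-1) * eta by rewrite ltr_pM2r.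
  by rewrite mulrDl mulVf ?gt_eqF//; lra.
pose N := Num.truncn X.
have N0 : (0 < N)%N by rewrite truncn_gt0.
have /andP[NX XN] := truncn_itv (le_trans ler01 X1); rewrite -/N -natr1 in NX XN.
have N1 : 1 <= N%:R :> R by rewrite ler1n.
have [p [q [/andP[q0 qN] cpq pq]]] := @coprime_dirichlet_approx R alpha N N0.
have cN := finite_type_exponent eta c _ q N q0 N0 (ac p q%:Z q0) pq.
have q0R : 0 < q%:R :> R by rewrite ltr0n.
have qN' : q%:R <= N%:R :> R by rewrite ler_nat.
have powE : r `^ (1 - lambda / (1 + eta)) = r * r `^ (- (lambda / (1 + eta))).
  by rewrite powRD ?rn0 ?implybT// powRr1// ltW.
(* the exponent of the bound comes from X^{1/eta} = r^{lambda/(1+eta)} *)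
have qX : (c / 2) `^ eta^-1 * r `^ (lambda / (1 + eta)) <= q%:R.
  have -> : r `^ (lambda / (1 + eta)) = X `^ eta^-1.
    rewrite /X -powRrM; congr (_ `^ _); field; apply/andP; split; lra.
  rewrite -powRM; [|lra|lra].
  have -> : q%:R = (q%:R `^ eta) `^ eta^-1 :> R.
    by rewrite -powRrM divff ?gt_eqF// powRr1// ltW.
  have cX : c / 2 * X <= q%:R `^ eta.
    apply: le_trans (ltW cN); rewrite -mulrA ler_pM2l//; lra.
  have cX0 : 0 <= c / 2 * X by rewrite mulr_ge0//; lra.
  by apply: ge0_ler_powR; rewrite ?nnegrE ?invr_ge0 ?powR_ge0 ?(ltW eta0).
have invq : q%:R^-1 <= ((c / 2) `^ eta^-1)^-1 * r `^ (- (lambda / (1 + eta))).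
  by rewrite powRN -invfM lef_pV2 ?posrE// mulr_gt0// powR_gt0.
have qe : q%:R * eps <= r `^ (- (lambda / (1 + eta))).
  apply: le_trans (_ : X * eps <= _); first by rewrite ler_pM2r//; lra.
  rewrite /X /eps -powRD ?rn0 ?implybT// le_eqVlt; apply/orP; left; apply/eqP.
  congr (_ `^ _); field; lra.
apply: le_trans (sum_wedge_count alpha eps q p M q0 cpq eps0) _.
rewrite powE.
move: invq qe; set T := r `^ (- (_ / _)) => invq qe.
have MR : M%:R / q%:R + 1 <= 2 * (r / q%:R).
  have : 1 <= r / q%:R by rewrite ler_pdivlMr//; lra.
  have : M%:R / q%:R <= r / q%:R by rewrite ler_pM2r ?invr_gt0.
  by lra.
have E5 : 1 + 4 * q%:R ^+ 2 * (`|alpha - p%:~R / q%:R| + eps) <=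
          5 + 4 * q%:R * (q%:R * eps).
  have : q%:R ^+ 2 * `|alpha - p%:~R / q%:R| <= 1.
    apply: le_trans (_ : q%:R ^+ 2 * (q%:R * N%:R)^-1 <= _).
      by rewrite ler_wpM2l// sqr_ge0.
    rewrite -ler_pdivlMr ?invr_gt0 ?mulr_gt0//; last by lra.
    by rewrite invrK mul1r expr2 ler_pM2l.
  by lra.
have E0 : 0 <= 5 + 4 * q%:R * (q%:R * eps).
  by rewrite addr_ge0 ?mulr_ge0// ltW.
have M0 : 0 <= M%:R / q%:R + 1 :> R by rewrite addr_ge0 ?divr_ge0.
apply: le_trans (_ : (2 * (r / q%:R)) * (5 + 4 * q%:R * (q%:R * eps))
  + 2 * eps * q%:R * (2 * r) <= _).
  apply: lerD; last first.
    by rewrite ler_wpM2l ?mulr_ge0 ?(ltW eps0)//; lra.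
  apply: le_trans (_ : (M%:R / q%:R + 1) * (5 + 4 * q%:R * (q%:R * eps)) <= _).
    by rewrite ler_wpM2l.
  by rewrite ler_wpM2r.
have -> : (2 * (r / q%:R)) * (5 + 4 * q%:R * (q%:R * eps))
  + 2 * eps * q%:R * (2 * r) = r * (10 * q%:R^-1 + 12 * (q%:R * eps)).
  by field; rewrite gt_eqF.
rewrite [_ * (r * T)]mulrCA ler_pM2l// [leRHS]mulrDl -[10 / _ * T]mulrA.
by apply: lerD; rewrite ler_pM2l.
Qed.

(** * Vertical sections of the sector *)

(** The square root vanishes on negative numbers, so this is also meaningful for
    [x > r]. *)
Definition halfchord {R : realType} (r x : R) : R := Num.sqrt (r ^+ 2 - x ^+ 2).

Definition sector_top {R : realType} (alpha eps r x : R) : R :=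
  Num.min ((alpha + eps) * x) (halfchord r x).

Definition sector_bot {R : realType} (alpha eps r x : R) : R :=
  Num.max ((alpha - eps) * x) (- halfchord r x).

(** For [eps >= 0] no case distinction is needed: the formula gives 0 for
    [x <= 0] and for [x >= r], where the section is empty or reduced to a point. *)
Definition sector_len {R : realType} (alpha eps r x : R) : R :=
  Num.max 0 (sector_top alpha eps r x - sector_bot alpha eps r x).

Lemma norm_le_halfchord {R : realType} (r x y : R) : 0 <= x <= r ->
  (x ^+ 2 + y ^+ 2 <= r ^+ 2) = (- halfchord r x <= y <= halfchord r x).
Proof.
move=> /andP[x0 xr]; rewrite -ler_norml -sqrtr_sqr ler_sqrt; last first.
  by rewrite subr_ge0 ler_sqr ?nnegrE//; lra.
by rewrite lerBrDl.
Qed.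

Lemma halfchord_out {R : realType} (r x : R) : 0 <= r <= x -> halfchord r x = 0.
Proof.
move=> /andP[r0 rx]; apply: ler0_sqrtr.
by rewrite subr_le0 ler_sqr ?nnegrE//; lra.
Qed.

Lemma SectP {R : realType} (alpha eps r x y : R) : 0 < x -> 0 <= r ->
  Sect alpha eps r (x, y) <->
  [/\ x <= r, (alpha - eps) * x < y < (alpha + eps) * x &
      - halfchord r x <= y <= halfchord r x].
Proof.
move=> x0 r0; rewrite /Sect/= ltr_pdivlMr// ltr_pdivrMr//; split.
  move=> [_ xyr ->]; have xr : x <= r.
    rewrite -[x <= r]ler_sqr ?nnegrE ?(ltW x0)//; have := sqr_ge0 y; lra.
  by split=> //; rewrite -norm_le_halfchord ?xr ?(ltW x0).
by move=> [xr -> ]; rewrite -norm_le_halfchord ?xr ?(ltW x0).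
Qed.

Lemma sector_len_ge0 {R : realType} (alpha eps r x : R) : 0 <= sector_len alpha eps r x.
Proof. by rewrite le_max lexx. Qed.

Lemma sector_len_le {R : realType} (alpha eps r x : R) : 0 <= eps -> 0 <= x ->
  sector_len alpha eps r x <= 2 * eps * x.
Proof.
move=> e0 x0; rewrite ge_max !mulr_ge0//=.
have : sector_top alpha eps r x <= (alpha + eps) * x by rewrite ge_min lexx.
have : (alpha - eps) * x <= sector_bot alpha eps r x by rewrite le_max lexx.
lra.
Qed.

Lemma sector_len_neg {R : realType} (alpha eps r x : R) : 0 <= eps -> x <= 0 ->
  sector_len alpha eps r x = 0.
Proof.
move=> e0 x0; apply/max_idPl.
have : sector_top alpha eps r x <= (alpha + eps) * x by rewrite ge_min lexx.
have : (alpha - eps) * x <= sector_bot alpha eps r x by rewrite le_max lexx.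
have : 0 <= eps * - x by rewrite mulr_ge0//; lra.
lra.
Qed.

Lemma sector_len_out {R : realType} (alpha eps r x : R) : 0 <= r <= x ->
  sector_len alpha eps r x = 0.
Proof.
move=> rx; apply/max_idPl; rewrite /sector_top /sector_bot halfchord_out// oppr0.
have : Num.min ((alpha + eps) * x) 0 <= 0 by rewrite ge_min lexx orbT.
have : 0 <= Num.max ((alpha - eps) * x) 0 by rewrite le_max lexx orbT.
lra.
Qed.

Lemma sector_len_full {R : realType} (alpha eps r x : R) : 0 <= eps -> 0 <= x ->
  (`|alpha| + eps) * x <= halfchord r x ->
  [/\ sector_top alpha eps r x = (alpha + eps) * x,
      sector_bot alpha eps r x = (alpha - eps) * x &
      sector_len alpha eps r x = 2 * eps * x].
Proof.
move=> e0 x0 h.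
have h1 : (alpha + eps) * x <= (`|alpha| + eps) * x.
  by rewrite ler_wpM2r// lerD2r ler_norm.
have h2 : - (alpha - eps) * x <= (`|alpha| + eps) * x.
  by rewrite ler_wpM2r// opprB addrC lerD2r -normrN ler_norm.
have topE : sector_top alpha eps r x = (alpha + eps) * x by apply/min_idPl; lra.
have botE : sector_bot alpha eps r x = (alpha - eps) * x by apply/max_idPl; lra.
split=> //; rewrite /sector_len topE botE.
rewrite -mulrBl; have -> : alpha + eps - (alpha - eps) = 2 * eps by ring.
by apply/max_idPr; rewrite !mulr_ge0.
Qed.

(** The section lies between the open and the closed interval with endpoints
    [sector_bot] and [sector_top]. *)
Lemma xsection_Sect {R : realType} (alpha eps r x : R) : 0 <= eps -> 0 <= r ->
  lebesgue_measure (xsection (Sect alpha eps r) x) = (sector_len alpha eps r x)%:E.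
Proof.
move=> e0 r0; have [x0|x0] := leP x 0.
  rewrite (_ : xsection _ _ = set0) ?measure0 ?sector_len_neg//.
  by apply/seteqP; split=> y //; rewrite /xsection/= inE => -[/=]; lra.
have [rx|xr] := ltP r x.
  rewrite (_ : xsection _ _ = set0) ?measure0 ?sector_len_out ?r0 ?ltW//.
  by apply/seteqP; split=> y //; rewrite /xsection/= inE SectP// => -[]; lra.
have -> : xsection (Sect alpha eps r) x =
    `](alpha - eps) * x, (alpha + eps) * x[ `&` `[- halfchord r x, halfchord r x].
  apply/seteqP; split=> y; rewrite /xsection/= inE SectP// !in_itv/=.
    by case.
  by case=> ? ?; split=> //; exact: ltW.
set S := (X in lebesgue_measure X).
have mS : measurable S by apply: measurableI; exact: measurable_itv.
set t := sector_top alpha eps r x; set b := sector_bot alpha eps r x.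
have S1 : [set` `]b, t[] `<=` S.
  move=> y; rewrite /S/= !in_itv/= /t /b /sector_top /sector_bot gt_max lt_min.
  by move=> /andP[/andP[-> h1] /andP[-> h2]]; split=> //; rewrite !ltW.
have S2 : S `<=` [set` `[b, t]].
  move=> y; rewrite /S/= !in_itv/= /t /b /sector_top /sector_bot ge_max le_min.
  by move=> [/andP[h1 h2] /andP[-> ->]]; rewrite !ltW.
have l1 : (lebesgue_measure [set` `]b, t[] <= lebesgue_measure S)%E.
  by apply: le_measure => //; rewrite inE//; exact: measurable_itv.
have l2 : (lebesgue_measure S <= lebesgue_measure [set` `[b, t]])%E.
  by apply: le_measure => //; rewrite inE//; exact: measurable_itv.
have lenE : (if (b < t) then (t%:E - b%:E)%E else 0%:E) = (sector_len alpha eps r x)%:E.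
  rewrite /sector_len -/t -/b; case: ltP => bt.
    by rewrite -EFinB; congr (_%:E); apply/esym/max_idPr; rewrite subr_ge0 ltW.
  by congr (_%:E); apply/esym/max_idPl; rewrite subr_le0.
apply/eqP; rewrite eq_le; move: l1 l2.
by rewrite !lebesgue_measure_itv/= !lte_fin lenE => -> ->.
Qed.

Lemma measurable_sector_len {R : realType} (alpha eps r : R) :
  measurable_fun setT (sector_len alpha eps r).
Proof.
have ma : measurable_fun setT (halfchord r).
  apply: continuous_measurable_fun => x.
  apply: (@continuous_comp _ _ _ (fun x : R => r ^+ 2 - x ^+ 2) Num.sqrt);
    last exact: sqrt_continuous.
  apply: cvgB; [exact: cvg_cst|exact: exprn_continuous].
have mc (c : R) : measurable_fun setT (fun x : R => c * x) by exact: measurable_funM.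
apply: measurable_maxr => //; apply: measurable_funB.
  exact: measurable_minr.
by apply: measurable_maxr => //; exact: measurableT_comp.
Qed.

(** * Area and lattice count as sums over columns *)

(** The statement is about extended reals because it also yields the
    finiteness of the integral. *)
Lemma integral_approx_steps {R : realType} (f e : nat -> R) (g : R -> R) (n : nat) :
  measurable_fun setT g -> (forall x, 0 <= g x) ->
  (forall k x, (k < n)%N -> k%:R <= x < k.+1%:R -> `|g x - f k| <= e k) ->
  ((\sum_(k < n) (f k - e k))%:E
     <= \int[lebesgue_measure]_(x in `[0%R, n%:R[) (g x)%:E
     <= (\sum_(k < n) (f k + e k))%:E)%E.
Proof.
move=> mg g0; elim: n => [|n ih] ge.
  by rewrite mulr0n set_itvco0 integral_set0 !big_ord0 lexx.
have /andP[ih1 ih2] := ih (fun k x kn => ge k x (ltnW kn)).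
have mE (A : set R) : measurable_fun A (EFin \o g).
  by apply/measurable_EFinP; exact: measurable_funTS.
have -> : `[0%R, n.+1%:R[%classic = `[0%R, n%:R[ `|` `[n%:R, n.+1%:R[ :> set R.
  apply/seteqP; split=> x /=; rewrite !in_itv/=.
    by have [xn|xn] := ltP x n%:R; [left|right]; lra.
  have n0 : 0 <= n%:R :> R by [].
  have nn : n%:R <= n.+1%:R :> R by rewrite ler_nat.
  by case=> /andP[h1 h2]; lra.
rewrite ge0_integral_setU//=; last 3 first.
- exact: mE.
- by move=> x _; rewrite lee_fin.
- rewrite disj_set2E; apply/eqP/seteqP; split=> x //=; rewrite !in_itv/=; lra.
have cstE (c : R) : (\int[lebesgue_measure]_(x in `[(n%:R : R), n.+1%:R[) c%:E)%E = c%:E.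
  rewrite integral_cst//= lebesgue_measure_itv/= lte_fin ltr_nat ltnSn.
  rewrite -EFinB -natrB// subSnn.
  by rewrite mule1.
have gn x : `[(n%:R : R), n.+1%:R[%classic x -> `|g x - f n| <= e n.
  by rewrite /= in_itv/= => h; apply: ge.
have nn : `[(n%:R : R), n.+1%:R[%classic n%:R.
  by rewrite /= in_itv/= lexx ltr_nat ltnSn.
rewrite !big_ord_recr/= !EFinD; apply/andP; split; apply: leeD => //.
  (* the lower bound of [g] has to be nonnegative to compare integrals *)
  apply: le_trans (_ : (Num.max 0 (f n - e n))%:E <= _)%E.
    by rewrite lee_fin le_max lexx orbT.
  rewrite -cstE; apply: ge0_le_integral => //.
  - by move=> x _; rewrite lee_fin le_max lexx.
  - exact: mE.
  move=> x /gn; rewrite lee_fin ge_max g0/= ler_norml; lra.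
rewrite -EFinD -cstE; apply: ge0_le_integral => //.
- by move=> x _; rewrite lee_fin.
- exact: mE.
- by move=> x /gn; rewrite lee_fin ler_norml; lra.
Qed.

(** The area is the integral of [sector_len] by definition of the product
    measure, and [sector_len] vanishes outside [0, n[. *)
Lemma Area_sector_len {R : realType} (alpha eps r : R) (n : nat) (e : nat -> R) :
  0 <= eps -> 0 <= r <= n%:R ->
  (forall k x, (k < n)%N -> k%:R <= x < k.+1%:R ->
     `|sector_len alpha eps r x - sector_len alpha eps r k%:R| <= e k) ->
  `|Area (Sect alpha eps r) - \sum_(k < n) sector_len alpha eps r k%:R|
     <= \sum_(k < n) e k.
Proof.
move=> e0 /andP[r0 rn] le.
have := @integral_approx_steps R (fun k => sector_len alpha eps r k%:R) e _ n
  (measurable_sector_len alpha eps r) (sector_len_ge0 alpha eps r) le.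
have -> : (\int[lebesgue_measure]_(x in `[0%R, n%:R[) (sector_len alpha eps r x)%:E)%E =
  (lebesgue_measure \x lebesgue_measure)%E (Sect alpha eps r).
  rewrite /product_measure1 integral_mkcond; apply: eq_integral => x _ /=.
  rewrite xsection_Sect// /patch; case: ifPn => //; rewrite notin_setE/= in_itv/=.
  move=> /negP; rewrite negb_and -ltNge -leNgt => /orP[x0|nx].
    by rewrite sector_len_neg// ltW.
  by rewrite sector_len_out// r0 (le_trans rn).
rewrite /Area; case: (_ (Sect _ _ _)) => [a| |]/=.
- by rewrite !lee_fin sumrB big_split/= ler_norml; lra.
- by rewrite leye_eq andbF.
- by [].
Qed.

(** The integers of a section form a half-open integer interval: the upper end is
    the ceiling of an open bound or the floor plus 1 of a closed one, the lower end
    the floor plus 1 of an open bound or the ceiling of a closed one. *)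
Definition sector_count {R : realType} (alpha eps r : R) (m : nat) : int :=
  Num.max 0 (Num.min (Num.ceil ((alpha + eps) * m%:R)) (Num.floor (halfchord r m%:R) + 1)
   - Num.max (Num.floor ((alpha - eps) * m%:R) + 1) (Num.ceil (- halfchord r m%:R))).

Lemma sector_count_ge0 {R : realType} (alpha eps r : R) (m : nat) :
  0 <= sector_count alpha eps r m.
Proof. by rewrite le_max lexx. Qed.

Lemma sector_countP {R : realType} (alpha eps r : R) (m : nat) (n : int) :
  let a := Num.max (Num.floor ((alpha - eps) * m%:R) + 1)
                   (Num.ceil (- halfchord r m%:R)) in
  [&& (alpha - eps) * m%:R < n%:~R < (alpha + eps) * m%:R &
      - halfchord r m%:R <= n%:~R <= halfchord r m%:R]
  = (a <= n < a + sector_count alpha eps r m).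
Proof.
rewrite -floor_lt_int -ceil_gt_int -ceil_le_int -floor_ge_int /sector_count.
set lo := Num.floor _; set hi := Num.ceil ((_ + _) * _).
set sl := Num.ceil _; set sh := Num.floor (halfchord _ _).
lia.
Qed.

(** The lattice points are listed column by column, without repetition. *)
Lemma lattice_countE {R : realType} (alpha eps r : R) : 0 <= r ->
  (lattice_count alpha eps r)%:R =
  \sum_(m < Num.truncn r) (sector_count alpha eps r m.+1)%:~R :> R.
Proof.
move=> r0; set M := Num.truncn r.
pose a (m : nat) := Num.max (Num.floor ((alpha - eps) * m%:R) + 1)
                            (Num.ceil (- halfchord r m%:R)).
pose t (m : nat) := [seq a m + k%:Z | k <- iota 0 `|sector_count alpha eps r m|%N].
pose s := [seq (m%:Z, n) | m <- iota 1 M, n <- t m].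
rewrite /lattice_count.
have -> : [set mn : int * int | Sect alpha eps r (mn.1%:~R, mn.2%:~R)] =
          [set` [fset x in s]%fset].
  apply/seteqP; split=> -[m n] /=; rewrite inE/=.
    move=> h; have m0 : 0 < m by case: h; rewrite /= ltr0z.
    move: h; case: m m0 => // m m0; rewrite -[_%:~R]/(m%:R) SectP ?ltr0n//.
    move=> [mr /andP[n1 n2] /andP[n3 n4]].
    apply/allpairsPdep; exists m, n; split=> //.
      rewrite mem_iota; have : (m <= M)%N by rewrite truncn_ge_nat.
      lia.
    have : a m <= n < a m + sector_count alpha eps r m.
      by rewrite -sector_countP n1 n2 n3 n4.
    move=> nam; apply/mapP; exists `|n - a m|%N; last by lia.
    by rewrite mem_iota/= add0n; lia.
  move=> /allpairsPdep[m' [n' [+ + [-> ->]]]].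
  rewrite mem_iota => m1 /mapP[k]; rewrite mem_iota add0n /= => kc ->.
  have c0 := sector_count_ge0 alpha eps r m'.
  have : a m' <= a m' + k%:Z < a m' + sector_count alpha eps r m' by lia.
  rewrite -sector_countP => /andP[n1 n2].
  apply/SectP => //; first by rewrite ltr0z; lia.
  have m'M : (m' <= M)%N by lia.
  by split=> //; rewrite -[_%:~R]/(m'%:R : R) -truncn_ge_nat.
rewrite set_fsetK card_fseq undup_id; last first.
  apply: allpairs_uniq_dep; first exact: iota_uniq.
    by move=> m _; rewrite map_inj_uniq ?iota_uniq// => i j /addrI[].
  by move=> [m n] [m' n'] _ _ /= [-> ->].
rewrite size_allpairs_dep sumnE big_map natr_sum.
have -> : iota 1 M = index_iota 1 M.+1 by rewrite /index_iota subSS subn0.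
rewrite big_add1 /= big_mkord; apply: eq_bigr => m _.
by rewrite size_map size_iota -[LHS]/((_)%:Z%:~R) gez0_abs// sector_count_ge0.
Qed.

Lemma intr_max {R : realType} (x y : int) :
  (Num.max x y)%:~R = Num.max x%:~R y%:~R :> R.
Proof. by rewrite !maxEle ler_int; case: ifP. Qed.

Lemma intr_min {R : realType} (x y : int) :
  (Num.min x y)%:~R = Num.min x%:~R y%:~R :> R.
Proof. by rewrite !minEle ler_int; case: ifP. Qed.

(** Rounding moves each endpoint of the section up by at most 1. *)
Lemma sector_count_len {R : realType} (alpha eps r : R) (m : nat) :
  `|(sector_count alpha eps r m)%:~R - sector_len alpha eps r m%:R| <= 1.
Proof.
rewrite /sector_count /sector_len intr_max intrB intr_min intr_max !intrD.
rewrite /sector_top /sector_bot -[1%:~R]/(1 : R) -[0%:~R]/(0 : R).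
set lo := (alpha - eps) * _; set hi := (alpha + eps) * _; set s := halfchord _ _.
have := floor_itv lo; have := floor_itv s; rewrite !intrD.
have := ceil_itv hi; have := ceil_itv (- s); rewrite !intrB -[1%:~R]/(1 : R).
move: (Num.ceil hi)%:~R (Num.ceil (- s))%:~R => chi cs.
move: (Num.floor lo)%:~R (Num.floor s)%:~R => flo fs.
move=> /andP[h1 h2] /andP[h3 h4] /andP[h5 h6] /andP[h7 h8].
have : Num.max lo (- s) <= Num.max (flo + 1) cs <= Num.max lo (- s) + 1.
  by case: (leP lo (- s)); case: (leP (flo + 1) cs); lra.
have : Num.min hi s <= Num.min chi (fs + 1) <= Num.min hi s + 1.
  by case: (leP hi s); case: (leP chi (fs + 1)); lra.
move: (Num.max (flo + 1) cs) (Num.max lo (- s)) (Num.min chi (fs + 1)) (Num.min hi s).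
move=> A B U T h h'.
by rewrite ler_norml; case: (leP 0 (U - A)); case: (leP 0 (T - B)); lra.
Qed.

Lemma sector_count_full {R : realType} (alpha eps r : R) (m : nat) : 0 < eps ->
  (`|alpha| + eps) * m.+1%:R <= halfchord r m.+1%:R ->
  (sector_count alpha eps r m.+1)%:~R = wedge_count alpha eps m.+1.
Proof.
move=> e0 h; have [t b _] := sector_len_full _ _ _ _ (ltW e0) (ler0n _ _) h.
have := wedge_count_ge0 alpha eps m e0.
rewrite /wedge_count /sector_count ler0z => w0.
have -> : Num.min (Num.ceil ((alpha + eps) * m.+1%:R))
    (Num.floor (halfchord r m.+1%:R) + 1) = Num.ceil ((alpha + eps) * m.+1%:R).
  apply/min_idPl; rewrite ceil_le_int ltW//; apply: le_lt_trans (floorD1_gt _).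
  by rewrite -t ge_min lexx orbT.
have -> : Num.max (Num.floor ((alpha - eps) * m.+1%:R) + 1)
    (Num.ceil (- halfchord r m.+1%:R)) = Num.floor ((alpha - eps) * m.+1%:R) + 1.
  apply/max_idPl; rewrite ceil_le_int ltW//; apply: le_lt_trans (floorD1_gt _).
  by rewrite -b le_max lexx orbT.
by rewrite opprD addrA; congr (_%:~R); apply/max_idPr.
Qed.

(** * Full and empty columns *)

(** The columns that end before the circle crosses the steepest of the lines
    [y = t x] with [|t| <= |alpha| + eps]. *)
Lemma halfchord_full {R : realType} (alpha eps r x : R) : 0 <= eps -> 0 <= x ->
  x ^+ 2 * (1 + (`|alpha| + eps) ^+ 2) <= r ^+ 2 ->
  (`|alpha| + eps) * x <= halfchord r x.
Proof.
move=> e0 x0 h.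
rewrite -[leLHS]ger0_norm ?mulr_ge0 ?addr_ge0// -sqrtr_sqr ler_sqrt.
  by rewrite exprMn; lra.
apply: le_trans (sqr_ge0 ((`|alpha| + eps) * x)) _; rewrite exprMn; lra.
Qed.

(** This compares the slopes [t] and [t + 2 eps] of the two sides of the sector:
    a ray of slope [t] meets the circle at an abscissa at most [1 + 2 eps] times
    that of a ray of slope [t + 2 eps]. *)
Lemma sector_widening {R : realType} (eps t : R) : 0 <= eps ->
  1 + (t + 2 * eps) ^+ 2 <= (1 + 2 * eps) ^+ 2 * (1 + t ^+ 2).
Proof.
move=> e0; have -> : (1 + 2 * eps) ^+ 2 * (1 + t ^+ 2) =
  1 + (t + 2 * eps) ^+ 2 + (eps * (3 * t ^+ 2 + (t - 2) ^+ 2)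
  + 4 * (eps * t) ^+ 2) by ring.
have h1 : 0 <= eps * (3 * t ^+ 2 + (t - 2) ^+ 2).
  by rewrite mulr_ge0//; have := sqr_ge0 t; have := sqr_ge0 (t - 2); lra.
by rewrite lerDl addr_ge0// mulr_ge0// sqr_ge0.
Qed.

(** Once [X] is past the point where the steep side of the sector leaves the
    disc, the flat side has left the disc at [(1 + 2 eps) X]; this bounds the
    width of the transition range.  If [|alpha| <= eps] there is no such [x]. *)
Lemma halfchord_empty {R : realType} (alpha eps r X x : R) :
  0 < eps -> 0 < X -> r ^+ 2 <= X ^+ 2 * (1 + (`|alpha| + eps) ^+ 2) ->
  (1 + 2 * eps) * X <= x <= r -> halfchord r x <= (`|alpha| - eps) * x.
Proof.
move=> e0 X0 rX /andP[Xx xr].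
have x0 : 0 <= x by apply: le_trans Xx; rewrite mulr_ge0//; lra.
have a0 := normr_ge0 alpha.
have x2 : ((1 + 2 * eps) * X) ^+ 2 <= x ^+ 2.
  by rewrite ler_sqr ?nnegrE// mulr_ge0//; lra.
have xr2 : x ^+ 2 <= r ^+ 2 by rewrite ler_sqr ?nnegrE//; lra.
set a := `|alpha| in rX a0 *.
have ea : eps < a.
  rewrite ltNge; apply/negP => ae.
  have : X ^+ 2 * (1 + (a + eps) ^+ 2) < X ^+ 2 * (1 + 2 * eps) ^+ 2.
    by rewrite ltr_pM2l ?exprn_gt0//; nra.
  rewrite exprMn in x2; lra.
have ax : 0 <= (a - eps) * x by rewrite mulr_ge0//; lra.
rewrite -[leRHS]ger0_norm// -sqrtr_sqr ler_sqrt ?sqr_ge0// exprMn.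
suff : r ^+ 2 <= x ^+ 2 * (1 + (a - eps) ^+ 2) by lra.
apply: le_trans (_ : ((1 + 2 * eps) * X) ^+ 2 * (1 + (a - eps) ^+ 2) <= _).
  apply: le_trans rX _; rewrite exprMn [_ * X ^+ 2]mulrC -[leRHS]mulrA.
  apply: ler_wpM2l; first exact: sqr_ge0.
  have -> : a + eps = (a - eps) + 2 * eps by ring.
  exact: sector_widening (ltW e0).
by apply: ler_wpM2r => //; rewrite addr_ge0 ?sqr_ge0.
Qed.

Lemma sector_len_empty {R : realType} (alpha eps r x : R) :
  halfchord r x <= (`|alpha| - eps) * x -> sector_len alpha eps r x = 0.
Proof.
move=> sx; apply/max_idPl; rewrite subr_le0.
have [al|al] := leP 0 alpha.
  apply: le_trans (_ : halfchord r x <= _); first by rewrite ge_min lexx orbT.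
  by rewrite le_max -{1}(ger0_norm al) sx.
apply: le_trans (_ : (alpha + eps) * x <= _); first by rewrite ge_min lexx.
rewrite le_max; apply/orP; right.
have -> : alpha + eps = - (`|alpha| - eps) by rewrite ltr0_norm//; ring.
by rewrite mulNr lerN2.
Qed.

Lemma sector_count_empty {R : realType} (alpha eps r : R) (m : nat) :
  halfchord r m%:R <= (`|alpha| - eps) * m%:R -> sector_count alpha eps r m = 0.
Proof.
move=> sx; apply/eqP; rewrite eq_le sector_count_ge0 andbT leNgt; apply/negP => c0.
pose a := Num.max (Num.floor ((alpha - eps) * m%:R) + 1) (Num.ceil (- halfchord r m%:R)).
have : a <= a < a + sector_count alpha eps r m by rewrite lexx ltrDl.
rewrite -sector_countP; move: (a%:~R : R) => n {a c0}/andP[/andP[n1 n2] /andP[n3 n4]].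
have [al|al] := leP 0 alpha; first by rewrite ger0_norm// in sx; lra.
by rewrite ltr0_norm// in sx; lra.
Qed.

(** Minima and maxima do not increase differences, so the variation of the section
    length is controlled by those of the two lines and of the arc. *)
Lemma sector_len_lip {R : realType} (alpha eps r x y : R) :
  0 <= eps <= 1 -> 0 <= r -> 0 <= x <= y ->
  `|sector_len alpha eps r y - sector_len alpha eps r x| <=
  2 * ((`|alpha| + 1) * (y - x) + (halfchord r x - halfchord r y)).
Proof.
move=> /andP[e0 e1] r0 /andP[x0 xy].
have sxy : halfchord r y <= halfchord r x.
  by apply: ler_wsqrtr; rewrite lerD2l lerN2 ler_sqr ?nnegrE//; lra.
set d := _ * (y - x).
have B (b : R) : `|b| <= `|alpha| + 1 -> - d <= b * y - b * x <= d.
  move=> hb; rewrite -ler_norml -mulrBr normrM [X in _ * X]ger0_norm; last by lra.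
  by rewrite /d ler_wpM2r//; lra.
have h1 : `|alpha + eps| <= `|alpha| + 1.
  by apply: le_trans (ler_normD _ _) _; rewrite lerD2l ger0_norm.
have h2 : `|alpha - eps| <= `|alpha| + 1.
  by apply: le_trans (ler_normB _ _) _; rewrite lerD2l ger0_norm.
have d0 : 0 <= d by apply: mulr_ge0; [exact: addr_ge0|lra].
have {h1} := B _ h1; have {h2} := B _ h2.
rewrite /sector_len /sector_top /sector_bot.
move: (halfchord r x) (halfchord r y) sxy => s t st.
clearbody d => {B}; move: ((alpha - eps) * y) ((alpha - eps) * x) => u v.
move: ((alpha + eps) * y) ((alpha + eps) * x) => u' v' h2 h1.
have hT : - (d + (s - t)) <= Num.min u' t - Num.min v' s <= d + (s - t).
  by case: (leP u' t); case: (leP v' s); lra.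
have hB : - (d + (s - t)) <= Num.max u (- t) - Num.max v (- s) <= d + (s - t).
  by case: (leP u (- t)); case: (leP v (- s)); lra.
move: (Num.min u' t) (Num.min v' s) (Num.max u (- t)) (Num.max v (- s)) hT hB.
move=> T T' C C' hT hB.
by rewrite ler_norml; case: (leP 0 (T - C)); case: (leP 0 (T' - C')); lra.
Qed.

(** * The two error estimates *)

Definition two_step {R : realType} (M d : nat) (A B : R) (k : nat) : R :=
  if (k < M)%N then A else if (k < M + d)%N then B else 0.

Lemma sum_two_step_le {R : realType} (M d n : nat) (A B : R) :
  0 <= A -> 0 <= B -> \sum_(k < n) two_step M d A B k <= M%:R * A + d%:R * B.
Proof.
move=> A0 B0.
have s0 k : 0 <= two_step M d A B k by rewrite /two_step; do 2?case: ifP.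
apply: (@le_trans _ _ (\sum_(k < (M + d) + n) two_step M d A B k)).
  by rewrite addnC [leRHS]big_split_ord/= lerDl sumr_ge0.
rewrite !big_split_ord/= [X in _ + X]big1 ?addr0; last first.
  by move=> k _; rewrite /two_step !ifF//; apply/negbTE; lia.
rewrite (eq_bigr (fun=> A)); last by move=> k _; rewrite /two_step ltn_ord.
rewrite sumr_const card_ord (eq_bigr (fun=> B)); last first.
  move=> k _; rewrite /two_step ifF ?ifT//; last by apply/negbTE; lia.
  by have := ltn_ord k; lia.
by rewrite sumr_const card_ord !mulr_natl.
Qed.

Lemma sum_sector_len {R : realType} (alpha eps r : R) (n : nat) : 0 <= eps ->
  \sum_(k < n.+1) sector_len alpha eps r k%:R =
  \sum_(k < n) sector_len alpha eps r k.+1%:R.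
Proof.
by move=> e0; rewrite big_ord_recl/= sector_len_neg// add0r.
Qed.

(** The function [V] bounds the variation of [sector_len], and it grows by
    [O(r)] over the whole range. *)
Lemma lattice_count_convex {R : realType} (alpha eps r : R) :
  0 <= eps <= 1 -> 1 <= r ->
  `|(lattice_count alpha eps r)%:R - Area (Sect alpha eps r)|
    <= (4 * `|alpha| + 7) * r.
Proof.
move=> e01 r1; have [e0 e1] := andP e01; have r0 : 0 <= r by lra.
rewrite lattice_countE//.
set M := Num.truncn r.
have /andP[Mr rM] := truncn_itv r0; rewrite -/M in Mr rM.
pose V (k : nat) : R := 2 * ((`|alpha| + 1) * k%:R - halfchord r k%:R).
have a0 := normr_ge0 alpha.
have : `|Area (Sect alpha eps r) - \sum_(k < M.+1) sector_len alpha eps r k%:R|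
    <= \sum_(k < M.+1) (V k.+1 - V k).
  apply: (Area_sector_len _ _ _ M.+1 (fun k => V k.+1 - V k) e0); first by rewrite r0 ltW.
  move=> k x _ /andP[kx xk]; apply: le_trans (sector_len_lip _ _ _ _ _ e01 r0 _) _.
    by rewrite ler0n.
  have : halfchord r k.+1%:R <= halfchord r x.
    have k0 := ler0n R k.
    by apply: ler_wsqrtr; rewrite lerD2l lerN2 ler_sqr ?nnegrE//; lra.
  have : (`|alpha| + 1) * (x - k%:R) <= (`|alpha| + 1) * (k.+1%:R - k%:R).
    by rewrite ler_wpM2l//; lra.
  by rewrite /V; lra.
rewrite -(big_mkord xpredT (fun k => V k.+1 - V k)) telescope_sumr//.
have V0 : V 0 = - 2 * r.
  by rewrite /V /halfchord mulr0n expr0n/= subr0 sqrtr_sqr (ger0_norm r0); ring.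
have VM : V M.+1 <= 2 * ((`|alpha| + 1) * (2 * r)).
  have h : (`|alpha| + 1) * M.+1%:R <= (`|alpha| + 1) * (2 * r).
    by rewrite ler_wpM2l ?addr_ge0// -natr1; lra.
  have : 0 <= halfchord r M.+1%:R by exact: sqrtr_ge0.
  by rewrite /V; lra.
have : `|\sum_(m < M) ((sector_count alpha eps r m.+1)%:~R
           - sector_len alpha eps r m.+1%:R)| <= M%:R.
  apply: le_trans (ler_norm_sum _ _ _) _.
  rewrite -[leRHS]mulr1 mulr_natl -[M in X in _ <= X]card_ord -sumr_const.
  by apply: ler_sum => m _; exact: sector_count_len.
rewrite sumrB sum_sector_len// V0.
move: VM; move: (V M.+1) (\sum_(m < M) _) (\sum_(m < M) _) (Area _) => v s t A.
by move=> VM; rewrite !ler_norml => h1 h2; lra.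
Qed.

(** A step function with value 0 on empty columns bounds both the rounding
    error beyond [M] and the Riemann sum error; on full columns the latter is
    [2 eps] per column because the section length is [2 eps x]. *)
Lemma lattice_count_wedge {R : realType} (alpha eps r : R) :
  0 < eps -> 1 <= r ->
  exists2 M : nat, M%:R <= r &
  `|(lattice_count alpha eps r)%:R - Area (Sect alpha eps r)| <=
  `|\sum_(i < M) (wedge_count alpha eps i.+1 - 2 * eps * i.+1%:R)|
    + 16 * (1 + eps * r) ^+ 2.
Proof.
move=> e0 r1; have r0 : 0 <= r by lra.
have a0 := normr_ge0 alpha.
pose D := 1 + (`|alpha| + eps) ^+ 2.
have D1 : 1 <= D by rewrite lerDl sqr_ge0.
have sD1 : 1 <= Num.sqrt D by rewrite -sqrtr1 ler_wsqrtr.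
have sD0 : 0 < Num.sqrt D by lra.
have sD2 : Num.sqrt D ^+ 2 = D by rewrite sqr_sqrtr//; lra.
(* at abscissa [r / sqrt D] the line of slope [|alpha| + eps] meets the circle *)
pose M1 := Num.truncn (r / Num.sqrt D).
have /andP[M1r rM1] := truncn_itv (divr_ge0 r0 (ltW sD0)).
rewrite -/M1 ler_pdivlMr// in M1r; rewrite -/M1 ltr_pdivrMr// in rM1.
clearbody M1.
have full (x : R) : 0 <= x <= M1%:R -> (`|alpha| + eps) * x <= halfchord r x.
  move=> /andP[x0 xM]; apply: halfchord_full => //; first exact: ltW.
  rewrite -/D -sD2 -exprMn ler_sqr ?nnegrE ?mulr_ge0 ?(ltW sD0)//.
  by apply: le_trans M1r; rewrite ler_pM2r.
have X2 : r ^+ 2 <= M1.+1%:R ^+ 2 * D.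
  by rewrite -sD2 -exprMn ler_sqr ?nnegrE ?mulr_ge0 ?(ltW sD0)// ltW.
have M1R : M1%:R <= r by apply: le_trans M1r; rewrite ler_peMr.
(* the columns from [M1 + d] on are empty *)
pose d := ((Num.truncn ((1 + 2 * eps) * M1.+1%:R)).+1 - M1)%N.
have X0 : 0 <= (1 + 2 * eps) * M1.+1%:R by rewrite mulr_ge0//; lra.
have /andP[T1 T2] := truncn_itv X0.
have M1T : (M1.+1 <= Num.truncn ((1 + 2 * eps) * M1.+1%:R))%N.
  by rewrite truncn_ge_nat// ler_peMl//; lra.
have dE : (M1 + d = (Num.truncn ((1 + 2 * eps) * M1.+1%:R)).+1)%N 
  by rewrite subnKC ?leqW ?(ltnW M1T).
have empty (x : R) : (M1 + d)%:R <= x <= r -> halfchord r x <= (`|alpha| - eps) * x.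
  move=> /andP[dx xr]; apply: (halfchord_empty _ _ _ M1.+1%:R) => //.
  by rewrite xr andbT; apply: le_trans (ltW T2) _; rewrite -dE.
have dle : d%:R <= 2 + 4 * (eps * r).
  have : (M1 + d)%:R <= (1 + 2 * eps) * M1.+1%:R + 1.
    by rewrite dE -natr1 lerD2r.
  have : eps * M1.+1%:R <= eps * (2 * r) by rewrite ler_pM2l// -natr1; lra.
  rewrite natrD -natr1; lra.
clear X0 T1 T2 M1T dE; clearbody d.
exists M1 => //; rewrite lattice_countE//.
set M := Num.truncn r.
have /andP[Mr rM] := truncn_itv r0; rewrite -/M in Mr rM.
have M1M : (M1 <= M)%N by rewrite truncn_ge_nat.
clear X2 sD1 sD0 sD2 M1r rM1 D1.
pose w (m : nat) := if (m < M1)%N then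
  wedge_count alpha eps m.+1 - 2 * eps * m.+1%:R else 0.
have wE : \sum_(m < M) w m =
    \sum_(i < M1) (wedge_count alpha eps i.+1 - 2 * eps * i.+1%:R).
  rewrite -(subnKC M1M) big_split_ord/= [X in _ + X]big1 ?addr0.
    by apply: eq_bigr => i _; rewrite /w ltn_ord.
  by move=> i _; rewrite /w ltnNge leq_addr.
have S1 : `|\sum_(m < M) ((sector_count alpha eps r m.+1)%:~R
     - sector_len alpha eps r m.+1%:R - w m)| <= d%:R.
  apply: le_trans (ler_norm_sum _ _ _) _.
  apply: (@le_trans _ _ (\sum_(m < M) two_step M1 d 0 1 m)); last first.
    by apply: le_trans (sum_two_step_le _ _ _ _ _ _ _) _; rewrite // mulr0 add0r mulr1.
  apply: ler_sum => -[m mM] _ /=; rewrite /two_step /w.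
  case: ltnP => mM1.
    have mf : (`|alpha| + eps) * m.+1%:R <= halfchord r m.+1%:R.
      by apply: full; rewrite ler0n ler_nat.
    have [_ _ ->] := sector_len_full _ _ _ _ (ltW e0) (ler0n _ _) mf.
    by rewrite sector_count_full// subrr normr0.
  rewrite subr0; case: ltnP => md; first exact: sector_count_len.
  have me : halfchord r m.+1%:R <= (`|alpha| - eps) * m.+1%:R.
    apply: empty; rewrite ler_nat (leq_trans md)//=.
    by apply: le_trans Mr; rewrite ler_nat.
  by rewrite sector_len_empty// sector_count_empty// subrr normr0.
have S2 : `|Area (Sect alpha eps r) - \sum_(k < M.+1) sector_len alpha eps r k%:R|
    <= M1%:R * (2 * eps) + d%:R * (4 * (eps * r)).
  have A0 : 0 <= 2 * eps by lra.
  have B0 : 0 <= 4 * (eps * r) by rewrite !mulr_ge0// ltW.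
  apply: le_trans (_ : \sum_(k < M.+1) two_step M1 d (2 * eps) (4 * (eps * r)) k <= _);
    last exact: sum_two_step_le.
  apply: (Area_sector_len _ _ _ M.+1 (two_step M1 d (2 * eps) (4 * (eps * r))) (ltW e0)).
    by rewrite r0 ltW.
  move=> k x kM /andP[kx xk].
  have k0 := ler0n R k; have x0 : 0 <= x by lra.
  have kr : k%:R <= r by apply: le_trans Mr; rewrite ler_nat.
  rewrite /two_step; case: ltnP => kM1.
    have kM1R : k.+1%:R <= M1%:R :> R by rewrite ler_nat.
    have x01 : 0 <= x <= M1%:R by lra.
    have k01 : 0 <= (k%:R : R) <= M1%:R by lra.
    have [_ _ ->] := sector_len_full _ _ _ _ (ltW e0) x0 (full x x01).
    have [_ _ ->] := sector_len_full _ _ _ _ (ltW e0) k0 (full k%:R k01).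
    rewrite -mulrBr normrM ger0_norm// -[leRHS]mulr1 ler_wpM2l// ler_norml.
    by rewrite -natr1 in xk; lra.
  case: ltnP => kd.
    have l1 : sector_len alpha eps r x <= 4 * (eps * r).
      apply: le_trans (sector_len_le alpha _ r _ (ltW e0) x0) _.
      have : eps * x <= eps * (2 * r) by rewrite ler_pM2l// -natr1 in xk *; lra.
      by lra.
    have l2 : sector_len alpha eps r k%:R <= 4 * (eps * r).
      apply: le_trans (sector_len_le alpha _ r _ (ltW e0) k0) _.
      have : eps * k%:R <= eps * (2 * r) by rewrite ler_pM2l//; lra.
      by lra.
    have := sector_len_ge0 alpha eps r x; have := sector_len_ge0 alpha eps r k%:R.
    by rewrite ler_norml; lra.
  have dk : (M1 + d)%:R <= k%:R :> R by rewrite ler_nat.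
  have -> : sector_len alpha eps r x = 0.
    have [xr|rx] := leP x r; last by rewrite sector_len_out// r0 ltW.
    by apply: sector_len_empty; apply: empty; lra.
  rewrite sector_len_empty ?subrr ?normr0//; apply: empty; lra.
have E0 : 0 <= eps * r by rewrite mulr_ge0// ltW.
have h1 : M1%:R * (2 * eps) <= 2 * (eps * r).
  have : M1%:R * eps <= r * eps by rewrite ler_pM2r.
  lra.
have h2 : d%:R * (4 * (eps * r)) <= (2 + 4 * (eps * r)) * (4 * (eps * r)).
  by rewrite ler_wpM2r// mulr_ge0.
rewrite !sumrB wE in S1; rewrite sum_sector_len ?(ltW e0)// in S2.
set W := (X in _ <= `|X| + _); rewrite -/W in S1.
have w1 := ler_norm W; have := ler_norm (- W); rewrite normrN => w2.
move: S1 S2; rewrite !ler_norml; lra.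
Qed.

(** * Asymptotics *)

Lemma eqaddO_pinfty {R : realType} (f g h : R -> R) (C : R) :
  (forall r, 1 <= r -> `|f r - g r| <= C * h r) -> f = g +O_ +oo h.
Proof.
move=> fgh; apply/eqaddOP => /=.
exists `|C|; split; first exact: num_real.
move=> k Ck; exists 1; split; first exact: num_real.
move=> r r1; apply: le_trans (fgh r (ltW r1)) _.
apply: le_trans (ler_norm _) _; rewrite normrM ler_wpM2r//; exact: ltW.
Qed.

Lemma lattice_count_finite_type {R : realType} (alpha eta lambda : R) :
  finite_type alpha eta -> 0 <= lambda < 1 + eta^-1 ->
  exists2 C : R, 0 <= C & forall r : R, 1 <= r ->
    `|(lattice_count alpha (r `^ (- lambda)) r)%:R
      - Area (Sect alpha (r `^ (- lambda)) r)| <=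
    C * r `^ (1 - lambda / (1 + eta)) + 16 * (1 + r `^ (1 - lambda)) ^+ 2.
Proof.
move=> ft l01; have [C C0 hC] := sum_wedge_count_finite_type _ _ _ ft l01.
exists C => // r r1; have r0 : 0 < r by lra.
have [M Mr h] := lattice_count_wedge alpha _ _ (powR_gt0 (- lambda) r0) r1.
apply: le_trans h _; apply: lerD; first exact: hC.
have -> // : r `^ (- lambda) * r = r `^ (1 - lambda).
by rewrite powRD ?(gt_eqF r0) ?implybT// powRr1 ?(ltW r0)// mulrC.
Qed.

(** Both 1 and [r ^ a] are at most [r ^ (e / 2)]. *)
Lemma sqr_1DpowR_le {R : realType} (r a e : R) : 1 <= r -> 0 <= e -> 2 * a <= e ->
  (1 + r `^ a) ^+ 2 <= 4 * r `^ e.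
Proof.
move=> r1 e0 ae; have r0 : 0 < r by lra.
pose y := r `^ (e / 2).
have y1 : 1 <= y by rewrite /y -{1}(powRr0 r) ler_powR//; lra.
have ay : r `^ a <= y by rewrite ler_powR//; lra.
have -> : r `^ e = y ^+ 2.
  by rewrite expr2 /y -powRD ?(gt_eqF r0) ?implybT//; congr (_ `^ _); lra.
have a0 : 0 <= r `^ a by exact: powR_ge0.
have -> : 4 * y ^+ 2 = (2 * y) ^+ 2 by ring.
by rewrite ler_sqr ?nnegrE; lra.
Qed.

Theorem corollary1p4 (R : realType) (alpha eta lambda : R)
    (alpha_irr : irrational alpha) (alpha_type : finite_type alpha eta) :
  [/\ 0 <= lambda < 2^-1 ->
        (fun r : R => (lattice_count alpha (r `^ (- lambda)) r)%:R : R) =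
        (fun r : R => Area (Sect alpha (r `^ (- lambda)) r))
          +O_ +oo (fun r : R => r),
      2^-1 <= lambda < (1 + eta) / (1 + 2 * eta) ->
        (fun r : R => (lattice_count alpha (r `^ (- lambda)) r)%:R : R) =
        (fun r : R => Area (Sect alpha (r `^ (- lambda)) r))
          +O_ +oo (fun r : R => r `^ (2 - 2 * lambda)) &
      (1 + eta) / (1 + 2 * eta) <= lambda < 1 + eta^-1 ->
        (fun r : R => (lattice_count alpha (r `^ (- lambda)) r)%:R : R) =
        (fun r : R => Area (Sect alpha (r `^ (- lambda)) r))
          +O_ +oo (fun r : R => r `^ (1 - lambda / (1 + eta)))].
Proof.
have eta1 := finite_type_ge1 _ _ alpha_type.
have narrow (e : R) : 0 <= lambda < 1 + eta^-1 -> 0 <= e ->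
    1 - lambda / (1 + eta) <= e -> 2 * (1 - lambda) <= e ->
    (fun r : R => (lattice_count alpha (r `^ (- lambda)) r)%:R : R) =
    (fun r : R => Area (Sect alpha (r `^ (- lambda)) r))
      +O_ +oo (fun r : R => r `^ e).
  move=> l01 e0 e1 e2.
  have [C C0 hC] := lattice_count_finite_type _ _ _ alpha_type l01.
  apply: (@eqaddO_pinfty _ _ _ _ (C + 64)) => r r1.
  apply: le_trans (hC r r1) _; rewrite [leRHS]mulrDl; apply: lerD.
    by apply: ler_wpM2l => //; exact: ler_powR.
  by have := sqr_1DpowR_le r _ _ r1 e0 e2; lra.
have eta0 : 0 < eta by lra.
have t1 : lambda = lambda / (1 + eta) * (1 + eta) by rewrite divfK// gt_eqF; lra.
set t := lambda / (1 + eta) in t1 narrow *.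
split=> /andP[l0 l1].
- apply: eqaddO_pinfty (4 * `|alpha| + 7) _ => r r1.
  apply: lattice_count_convex => //; rewrite powR_ge0/=.
  by rewrite -(powRr0 r) ler_powR//; lra.
(* the threshold decides which of [1 - t] and [2 * (1 - lambda)] is larger *)
- have l : lambda * (1 + 2 * eta) < 1 + eta by rewrite -ltr_pdivlMr//; lra.
  have i0 : 0 < eta^-1 by rewrite invr_gt0.
  apply: narrow; nra.
- have l : 1 + eta <= lambda * (1 + 2 * eta) by rewrite -ler_pdivrMr//; lra.
  have i1 : eta^-1 <= 1 by rewrite invf_le1.
  apply: narrow; nra.
Qed.
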